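(* Let $t,s,d$ be positive integers with $s<t$, and put $m=ts$, $n=sd$. Let $P_C$ be an integer with $0\le P_C<P$, and put $\Delta_{P_C}=\lceil P_C/s\rceil$ and $t^*=t+\Delta_{P_C}$. Define $$P_R=\begin{cases} tsd+s-1, & \text{if } P_C=0,\\ t^*s(d+1)+s\Delta_{P_C}-1, & \text{if } P_C\ge 1 \text{ and } \Delta_{P_C}=P_C/s,\\ t^*s(d+1)-s\Delta_{P_C}+2P_C-1, & \text{if } P_C\ge 1 \text{ and } \Delta_{P_C}>P_C/s,\end{cases}$$ and assume $P_R\le P$. Then the secure generalized PolyDot (SGPD) code for the case $s<t$ (defined in the context) is feasible with security level $P_C$ and recovery threshold $P_R$, and it has communication load $C_L=P_R\,\frac{TD}{td}$. That is: (security) $I(\mathbf A_{\mathcal P},\mathbf B_{\mathcal P};\mathbf A,\mathbf B)=0$ for every $\mathcal P\subset\{1,\dots,P\}$ with $|\mathcal P|=P_C$; (decodability) $H(\mathbf A\mathbf B\mid\{\mathbf C_p\}_{p\in\mathcal P_R})=0$ for every $\mathcal P_R\subset\{1,\dots,P\}$ with $|\mathcal P_R|=P_R$; and (load) $\sum_{p\in\mathcal P_R}|\mathbf C_p|=P_R\,\frac{TD}{td}$ for every such $\mathcal P_R$.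
   Context: Secure distributed matrix multiplication. $\mathbb F$ is a finite field and $P$ is the number of workers, with $|\mathbb F|>P$. $\mathbf A\in\mathbb F^{T\times S}$ and $\mathbf B\in\mathbb F^{S\times D}$ are independent random matrices with i.i.d. entries uniform on $\mathbb F$. The integers satisfy $t\mid T$, $s\mid S$, $d\mid D$. A master sends to worker $p\in\{1,\dots,P\}$ an encoded matrix $\mathbf A_p\in\mathbb F^{T/t\times S/s}$, a function of $\mathbf A$ and of random matrices independent of the data, and an encoded matrix $\mathbf B_p\in\mathbb F^{S/s\times D/d}$, a function of $\mathbf B$ and of independent random matrices. Worker $p$ returns $\mathbf C_p=\mathbf A_p\mathbf B_p\in\mathbb F^{T/t\times D/d}$, and the master must recover $\mathbf A\mathbf B$ from the outputs of $P_R$ workers. For a set $\mathcal P$ of workers, $\mathbf A_{\mathcal P}=\{\mathbf A_p\}_{p\in\mathcal P}$ and $\mathbf B_{\mathcal P}=\{\mathbf B_p\}_{p\in\mathcal P}$. $H$ is entropy, $I$ is mutual information, and $|\mathbf C_p|$ is the number of entries of $\mathbf C_p$. The communication load is $C_L=\sum_{p\in\mathcal P_R}|\mathbf C_p|$. SGPD code, case $s<t$. Partition $\mathbf A$ into $t\times s$ blocks $\mathbf A_{i,j}\in\mathbb F^{T/t\times S/s}$ ($1\le i\le t$, $1\le j\le s$) and $\mathbf B$ into $s\times d$ blocks $\mathbf B_{k,l}\in\mathbb F^{S/s\times D/d}$ ($1\le k\le s$, $1\le l\le d$). Let $\mathbf R_0,\dots,\mathbf R_{P_C-1}\in\mathbb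 F^{T/t\times S/s}$ and $\mathbf R'_0,\dots,\mathbf R'_{P_C-1}\in\mathbb F^{S/s\times D/d}$ be random matrices with i.i.d. uniform entries in $\mathbb F$, mutually independent and independent of $(\mathbf A,\mathbf B)$. With $\Delta_{P_C}=\lceil P_C/s\rceil$ and $t^*=t+\Delta_{P_C}$, define the matrix polynomials $$\mathbf F_{\mathbf a^*}(z)=\sum_{i=1}^t\sum_{j=1}^s\mathbf A_{i,j}z^{s(i-1)+j-1}+\sum_{r=0}^{P_C-1}\mathbf R_r z^{ts+r},$$ $$\mathbf F_{\mathbf b^*}(z)=\sum_{k=1}^s\sum_{l=1}^d\mathbf B_{k,l}z^{s-k+t^*s(l-1)}+\sum_{r=0}^{P_C-1}\mathbf R'_r z^{t^*sd+r}.$$ Fix distinct non-zero points $z_1,\dots,z_P\in\mathbb F$. The code sets $\mathbf A_p=\mathbf F_{\mathbf a^*}(z_p)$ and $\mathbf B_p=\mathbf F_{\mathbf b^*}(z_p)$ for $p=1,\dots,P$. *)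

(* Defs.v *)
From HB Require Import structures.
From mathcomp Require Import all_boot all_order all_algebra.
From mathcomp Require Import all_classical all_reals all_analysis.

Set Implicit Arguments.
Unset Strict Implicit.
Unset Printing Implicit Defensive.

Import Order.TTheory GRing.Theory Num.Theory.

Local Open Scope classical_set_scope.
Local Open Scope ring_scope.

(* Measurability with respect to the discrete sigma-algebra on V. *)
Definition discrete_rv (dsp : measure_display) (Omega : measurableType dsp)
    (V : finType) (X : Omega -> V) : Prop :=
  forall x : V, measurable (X @^-1` [set x]).

Definition prob_in (R : realType) (dsp : measure_display)
    (Omega : measurableType dsp) (Pr : probability Omega R)
    (V : finType) (X : Omega -> V) (E : {set V}) : R :=
  fine (Pr [set w | X w \in E]).

Definition pmf_of (R : realType) (dsp : measure_display)
    (Omega : measurableType dsp) (Pr : probability Omega R)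
    (V : finType) (X : Omega -> V) (x : V) : R :=
  fine (Pr (X @^-1` [set x])).

Definition joint (Omega : Type) (V W : Type) (X : Omega -> V) (Y : Omega -> W) :
    Omega -> V * W :=
  fun w => (X w, Y w).

Definition joint_family (Omega : Type) (I : finType) (V : Type)
    (X : I -> Omega -> V) : Omega -> {ffun I -> V} :=
  fun w => [ffun i => X i w].

Definition independent_pair (R : realType) (dsp : measure_display)
    (Omega : measurableType dsp) (Pr : probability Omega R)
    (V W : finType) (X : Omega -> V) (Y : Omega -> W) : Prop :=
  forall (E : {set V}) (E' : {set W}),
    fine (Pr [set w | X w \in E /\ Y w \in E']) =
    prob_in Pr X E * prob_in Pr Y E'.

(* The product rule for subfamilies is included: take E i to be everything
   outside the subfamily. *)
Definition mutually_independent (R : realType) (dsp : measure_display)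
    (Omega : measurableType dsp) (Pr : probability Omega R)
    (I : finType) (V : I -> finType) (X : forall i, Omega -> V i) : Prop :=
  forall E : forall i, {set V i},
    fine (Pr [set w | forall i, X i w \in E i]) =
    \prod_i prob_in Pr (X i) (E i).

Definition uniform_rv (R : realType) (dsp : measure_display)
    (Omega : measurableType dsp) (Pr : probability Omega R)
    (V : finType) (X : Omega -> V) : Prop :=
  forall x : V, pmf_of Pr X x = (#|V|%:R)^-1.

Definition iid_uniform_entries (R : realType) (dsp : measure_display)
    (Omega : measurableType dsp) (Pr : probability Omega R)
    (F : finFieldType) (m n : nat) (M : Omega -> 'M[F]_(m, n)) : Prop :=
  mutually_independent Pr
    (fun (ij : 'I_m * 'I_n) (w : Omega) => M w ij.1 ij.2) /\
  (forall i j, uniform_rv Pr (fun w => M w i j)).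

(* Shannon quantities are in nats; the base of the logarithm only rescales them.
   ln 0 = 0 and x / 0 = 0, so terms of probability 0 vanish, in agreement with
   the convention 0 log 0 = 0. *)
Definition cond_entropy (R : realType) (dsp : measure_display)
    (Omega : measurableType dsp) (Pr : probability Omega R)
    (V W : finType) (X : Omega -> V) (Y : Omega -> W) : R :=
  - \sum_(x : V) \sum_(y : W)
      pmf_of Pr (joint X Y) (x, y) *
      ln (pmf_of Pr (joint X Y) (x, y) / pmf_of Pr Y y).

Definition mutual_info (R : realType) (dsp : measure_display)
    (Omega : measurableType dsp) (Pr : probability Omega R)
    (V W : finType) (X : Omega -> V) (Y : Omega -> W) : R :=
  \sum_(x : V) \sum_(y : W)
    pmf_of Pr (joint X Y) (x, y) *
    ln (pmf_of Pr (joint X Y) (x, y) / (pmf_of Pr X x * pmf_of Pr Y y)).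

Lemma block_index_subproof (N k : nat) (i : 'I_k) (a : 'I_(N %/ k)) :
  (i * (N %/ k) + a < N)%N.
Proof.
apply: (@leq_trans (i.+1 * (N %/ k))%N).
  by rewrite mulSn addnC ltn_add2r.
by rewrite (leq_trans _ (leq_divM N k)) // mulnC leq_mul2l ltn_ord orbT.
Qed.

Definition block_index (N k : nat) (i : 'I_k) (a : 'I_(N %/ k)) : 'I_N :=
  Ordinal (block_index_subproof i a).

(* Block (i, j), counted from 0, of the k x l partition of M; it is a partition
   when k divides m and l divides n. *)
Definition block (F : Type) (m n k l : nat) (M : 'M[F]_(m, n))
    (i : 'I_k) (j : 'I_l) : 'M[F]_(m %/ k, n %/ l) :=
  \matrix_(a, b) M (block_index i a) (block_index j b).

Definition ceil_div (m n : nat) : nat := (m + n.-1) %/ n.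

Lemma ceil_div_leq (m n k : nat) :
  (0 < n)%N -> (ceil_div m n <= k)%N = (m <= k * n)%N.
Proof.
by case: n => // n _; rewrite /ceil_div -ltnS ltn_divLR // mulSn /= addnC addSn
  ltnS leq_add2l.
Qed.

Definition Delta (s PC : nat) : nat := ceil_div PC s.

Definition tstar (t s PC : nat) : nat := (t + Delta s PC)%N.

(* The subtractions never truncate when 0 < s. *)
Definition recovery_threshold (t s d PC : nat) : nat :=
  if PC == 0%N then (t * s * d + s - 1)%N
  else if (Delta s PC)%:R == PC%:R / s%:R :> rat
  then (tstar t s PC * s * d.+1 + s * Delta s PC - 1)%N
  else (tstar t s PC * s * d.+1 - s * Delta s PC + 2 * PC - 1)%N.

(* A matrix polynomial is a matrix with polynomial entries. *)
Definition const_mxpoly (F : finFieldType) (m n : nat) (M : 'M[F]_(m, n)) :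
    'M[{poly F}]_(m, n) := map_mx (@polyC F) M.

Definition eval_mxpoly (F : finFieldType) (m n : nat)
    (G : 'M[{poly F}]_(m, n)) (x : F) : 'M[F]_(m, n) :=
  map_mx (fun p : {poly F} => p.[x]) G.

(* With i, j counted from 0, the exponent s(i-1)+j-1 reads s * i + j. *)
Definition Fa (F : finFieldType) (t s PC T S : nat) (A : 'M[F]_(T, S))
    (N : 'I_PC -> 'M[F]_(T %/ t, S %/ s)) :
    'M[{poly F}]_(T %/ t, S %/ s) :=
  \sum_(i < t) \sum_(j < s) 'X^(s * i + j) *: const_mxpoly (block A i j) +
  \sum_(r < PC) 'X^(t * s + r) *: const_mxpoly (N r).

(* With k, l counted from 0, the exponent s-k+t^*s(l-1) reads
   s - k.+1 + tstar * s * l. *)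
Definition Fb (F : finFieldType) (t s d PC S D : nat) (B : 'M[F]_(S, D))
    (N' : 'I_PC -> 'M[F]_(S %/ s, D %/ d)) :
    'M[{poly F}]_(S %/ s, D %/ d) :=
  \sum_(k < s) \sum_(l < d)
     'X^(s - k.+1 + tstar t s PC * s * l) *: const_mxpoly (block B k l) +
  \sum_(r < PC) 'X^(tstar t s PC * s * d + r) *: const_mxpoly (N' r).

Definition enc_A (F : finFieldType) (Omega : Type) (t s PC T S P : nat)
    (A : Omega -> 'M[F]_(T, S))
    (N : 'I_PC -> Omega -> 'M[F]_(T %/ t, S %/ s))
    (z : 'I_P -> F) (p : 'I_P) (w : Omega) : 'M[F]_(T %/ t, S %/ s) :=
  eval_mxpoly (Fa (A w) (fun r => N r w)) (z p).

Definition enc_B (F : finFieldType) (Omega : Type) (t s d PC S D P : nat)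
    (B : Omega -> 'M[F]_(S, D))
    (N' : 'I_PC -> Omega -> 'M[F]_(S %/ s, D %/ d))
    (z : 'I_P -> F) (p : 'I_P) (w : Omega) : 'M[F]_(S %/ s, D %/ d) :=
  eval_mxpoly (Fb t (B w) (fun r => N' r w)) (z p).

Definition worker_output (F : finFieldType) (Omega : Type) (I : Type)
    (m n k : nat) (Ap : I -> Omega -> 'M[F]_(m, n))
    (Bp : I -> Omega -> 'M[F]_(n, k)) (p : I) (w : Omega) : 'M[F]_(m, k) :=
  Ap p w *m Bp p w.

Definition data_product (F : finFieldType) (Omega : Type) (T S D : nat)
    (A : Omega -> 'M[F]_(T, S)) (B : Omega -> 'M[F]_(S, D)) (w : Omega) :
    'M[F]_(T, D) := A w *m B w.

(* The family of all noise matrices, R_r on the left and R'_r on the right. *)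
Definition noise_space (F : finFieldType) (PC m n k : nat)
    (i : 'I_PC + 'I_PC) : finType :=
  match i with
  | inl _ => 'M[F]_(m, n) : finType
  | inr _ => 'M[F]_(n, k) : finType
  end.

Definition noise_family (F : finFieldType) (Omega : Type) (PC m n k : nat)
    (N : 'I_PC -> Omega -> 'M[F]_(m, n)) (N' : 'I_PC -> Omega -> 'M[F]_(n, k))
    (i : 'I_PC + 'I_PC) : Omega -> noise_space F m n k i :=
  match i with
  | inl r => N r
  | inr r => N' r
  end.

(* The family (X_p) for p in Q, as one random variable. *)
Definition restricted (Omega : Type) (P : nat) (V : Type) (Q : {set 'I_P})
    (X : 'I_P -> Omega -> V) : Omega -> {ffun {p : 'I_P | p \in Q} -> V} :=
  joint_family (fun p : {p : 'I_P | p \in Q} => X (val p)).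

Definition secure (R : realType) (dsp : measure_display)
    (Omega : measurableType dsp) (Pr : probability Omega R)
    (F : finFieldType) (P T S D m n k PC : nat)
    (A : Omega -> 'M[F]_(T, S)) (B : Omega -> 'M[F]_(S, D))
    (Ap : 'I_P -> Omega -> 'M[F]_(m, n))
    (Bp : 'I_P -> Omega -> 'M[F]_(n, k)) : Prop :=
  forall Q : {set 'I_P}, #|Q| = PC ->
    mutual_info Pr (joint (restricted Q Ap) (restricted Q Bp)) (joint A B) = 0.

Definition decodable (R : realType) (dsp : measure_display)
    (Omega : measurableType dsp) (Pr : probability Omega R)
    (F : finFieldType) (P T S D m k PR : nat)
    (A : Omega -> 'M[F]_(T, S)) (B : Omega -> 'M[F]_(S, D))
    (Cp : 'I_P -> Omega -> 'M[F]_(m, k)) : Prop :=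
  forall Q : {set 'I_P}, #|Q| = PR ->
    cond_entropy Pr (data_product A B) (restricted Q Cp) = 0.

Definition num_entries (F : Type) (m n : nat) (M : 'M[F]_(m, n)) : nat :=
  #|{: 'I_m * 'I_n}|.

Definition comm_load (F : finFieldType) (Omega : Type) (P m k : nat)
    (Cp : 'I_P -> Omega -> 'M[F]_(m, k)) (Q : {set 'I_P}) (w : Omega) : nat :=
  (\sum_(p in Q) num_entries (Cp p w))%N.

(* Main.v *)
(* Decodability: the entries of Fa *m Fb are polynomials of degree less than
   P_R, hence determined by the outputs at P_R distinct points.  The exponents
   are arranged so that the coefficient of degree s i + (s - 1) + t^* s l
   (i, l counted from 0) collects exactly the products A_(i,k) B_(k,l), that is,
   the block (i, l) of A B.
   Security: for fixed data, the shares of P_C workers are an affine function of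
   the noise whose linear part is a Vandermonde system scaled by powers of the
   non-zero evaluation points.  It is injective between sets of equal size, so
   uniform noise acts as a one-time pad. *)

Require Import Defs.
From HB Require Import structures.
From mathcomp Require Import all_boot all_order all_algebra.
From mathcomp Require Import all_classical all_reals all_analysis.
From mathcomp Require Import zify ring.

Set Implicit Arguments.
Unset Strict Implicit.
Unset Printing Implicit Defensive.

Import Order.TTheory GRing.Theory Num.Theory.
Local Open Scope ring_scope.

(** * Finite-valued random variables and vanishing of information quantities *)

Lemma prob_in1 (R : realType) (dsp : measure_display)
    (Omega : measurableType dsp) (Pr : probability Omega R) (V : finType)
    (X : Omega -> V) (x : V) :
  prob_in Pr X [set x] = pmf_of Pr X x.
Proof.
congr (fine (Pr _)); apply/seteqP; split => w /=; first by move/set1P.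
by move=> ->; rewrite inE.
Qed.

Lemma discrete_joint (dsp : measure_display) (Omega : measurableType dsp)
    (V W : finType) (X : Omega -> V) (Y : Omega -> W) :
  discrete_rv X -> discrete_rv Y -> discrete_rv (joint X Y).
Proof.
move=> mX mY [x y].
suff -> : (joint X Y @^-1` [set (x, y)] = X @^-1` [set x] `&` Y @^-1` [set y])%classic.
  exact: measurableI.
by apply/seteqP; split => w /=; rewrite /joint => -[-> ->].
Qed.

Lemma discrete_joint_family (dsp : measure_display)
    (Omega : measurableType dsp) (I V : finType) (X : I -> Omega -> V) :
  (forall i, discrete_rv (X i)) -> discrete_rv (joint_family X).
Proof.
move=> mX f.
suff -> : (joint_family X @^-1` [set f] =
    \bigcap_(i in [set: I]) X i @^-1` [set f i])%classic.
  by apply: fin_bigcap_measurable => // i _; apply: mX.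
apply/seteqP; split => w /=.
  by move=> <- i _ /=; rewrite ffunE.
by move=> Xf; apply/ffunP => i; rewrite ffunE; apply: Xf.
Qed.

Lemma pmf_marginal (R : realType) (dsp : measure_display)
    (Omega : measurableType dsp) (Pr : probability Omega R) (V W : finType)
    (X : Omega -> V) (Y : Omega -> W) (x : V) :
  discrete_rv (joint X Y) ->
  pmf_of Pr X x = \sum_y pmf_of Pr (joint X Y) (x, y).
Proof.
move=> mXY; rewrite /pmf_of.
have -> : (X @^-1` [set x] =
    \bigcup_(y in [set` index_enum W]) joint X Y @^-1` [set (x, y)])%classic.
  apply/seteqP; split => w /=; last by case=> y _ [].
  by move=> Xx; exists (Y w); rewrite /= ?mem_index_enum // /joint Xx.
rewrite measure_fin_bigcup //; last first.
  by move=> y1 y2 _ _ [w [[_ <-] [_ <-]]].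
rewrite -fsbig_seq ?index_enum_uniq // sum_fine // => y _.
exact: fin_num_measure.
Qed.

Lemma mutual_info_indep (R : realType) (dsp : measure_display)
    (Omega : measurableType dsp) (Pr : probability Omega R) (V W : finType)
    (X : Omega -> V) (Y : Omega -> W) :
  (forall x y,
     pmf_of Pr (joint X Y) (x, y) = pmf_of Pr X x * pmf_of Pr Y y) ->
  mutual_info Pr X Y = 0.
Proof.
move=> indep; rewrite /mutual_info big1 // => x _; rewrite big1 // => y _.
(* A pair of probability 0 contributes 0 through its weight; for any other pair the logarithm is
   that of 1. *)
rewrite indep; have [-> | nz] := eqVneq (pmf_of Pr X x * pmf_of Pr Y y) 0.
  by rewrite mul0r.
by rewrite divff // ln1 mulr0.
Qed.

(** For an attained pair [(x, y)] the event [Y = y] lies inside [X = x], so the ratio in the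
    logarithm is 1 unless its weight is 0. For any other pair the joint event is empty. *)
Lemma cond_entropy_determined (R : realType) (dsp : measure_display)
    (Omega : measurableType dsp) (Pr : probability Omega R) (V W : finType)
    (X : Omega -> V) (Y : Omega -> W) :
  (forall w w', Y w = Y w' -> X w = X w') -> cond_entropy Pr X Y = 0.
Proof.
move=> det; rewrite /cond_entropy big1 ?oppr0 // => x _; rewrite big1 // => y _.
have [[w [Xw Yw]] | none] := pselect (exists w, X w = x /\ Y w = y).
  have -> : pmf_of Pr (joint X Y) (x, y) = pmf_of Pr Y y.
    congr (fine (Pr _)); apply/seteqP; split => v /=; rewrite /joint.
      by case.
    by move=> Yv; rewrite Yv -Xw (det v w) // Yv Yw.
  have [-> | nz] := eqVneq (pmf_of Pr Y y) 0; first by rewrite mul0r.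
  by rewrite divff // ln1 mulr0.
suff -> : pmf_of Pr (joint X Y) (x, y) = 0 by rewrite mul0r.
rewrite /pmf_of.
have -> : (joint X Y @^-1` [set (x, y)] = set0)%classic; last by rewrite measure0.
by apply/seteqP; split => v //= -[Xv Yv]; apply: none; exists v.
Qed.

(* The one-time pad: for each value of the data Y, the key U ranges bijectively
   over the encodings. *)
Lemma mutual_info_one_time_pad (R : realType) (dsp : measure_display)
    (Omega : measurableType dsp) (Pr : probability Omega R) (U V W : finType)
    (K : Omega -> U) (Y : Omega -> W) (phi : U -> W -> V) (c : R) :
  discrete_rv K -> discrete_rv Y -> independent_pair Pr K Y ->
  (forall u, pmf_of Pr K u = c) -> (#|V| <= #|U|)%N ->
  (forall y, injective (phi ^~ y)) ->
  mutual_info Pr (fun w => phi (K w) (Y w)) Y = 0.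
Proof.
move=> mK mY KY Kc VU phi_inj; set X := fun w => _.
have preim x y : exists u, (joint X Y @^-1` [set (x, y)] =
    [set w | K w \in [set u]%SET /\ Y w \in [set y]%SET])%classic.
  (* Injectivity and the cardinality bound make [phi ^~ y] onto, so exactly one key [u] encodes [y]
     as [x]. *)
  have /codomP[u xu] := inj_card_onto (phi_inj y) VU x.
  exists u; apply/seteqP; split => w /=; rewrite /joint /X.
    by case=> + Yy; rewrite Yy xu => /phi_inj ->; rewrite !inE.
  by case=> /set1P Ku /set1P Yy; rewrite Ku Yy xu.
have mXY : discrete_rv (joint X Y).
  move=> [x y]; have [u ->] := preim x y.
  suff -> : ([set w | K w \in [set u]%SET /\ Y w \in [set y]%SET] =
      K @^-1` [set u] `&` Y @^-1` [set y])%classic by apply: measurableI.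
  apply/seteqP; split => w /=; first by case=> /set1P ? /set1P ?.
  by case=> -> ->; rewrite !inE.
have joint_pmf x y : pmf_of Pr (joint X Y) (x, y) = c * pmf_of Pr Y y.
  by have [u e] := preim x y; rewrite {1}/pmf_of e KY !prob_in1 Kc.
(* The total mass is read off as the marginal of a constant variable paired with [Y]. *)
have Y_total : \sum_y pmf_of Pr Y y = 1.
  have mYt : discrete_rv (joint (fun=> tt) Y).
    by apply: discrete_joint => // t0; rewrite preimage_cst; case: ifP.
  have := pmf_marginal Pr tt mYt.
  rewrite {1}/pmf_of.
  have -> : ((fun=> tt) @^-1` [set tt] = [set: Omega])%classic.
    by apply/seteqP; split => w.
  rewrite probability_setT /= => ->; apply: eq_bigr => y _.
  congr (fine (Pr _)); apply/seteqP; split => w /=; rewrite /joint; last by case.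
  by move=> ->.
(* Summing [joint_pmf] over [y] shows that [X] has the constant pmf [c], so the joint pmf
   factors. *)
apply: mutual_info_indep => x y; rewrite joint_pmf; congr (_ * _).
rewrite (pmf_marginal Pr x mXY) (eq_bigr _ (fun y _ => joint_pmf x y)).
by rewrite -mulr_sumr Y_total mulr1.
Qed.

(** * Point probabilities of uniform matrices and of the noise *)

Lemma pmf_iid_uniform_entries (R : realType) (dsp : measure_display)
    (Omega : measurableType dsp) (Pr : probability Omega R)
    (F : finFieldType) (m n : nat) (M : Omega -> 'M[F]_(m, n)) (x : 'M[F]_(m, n)) :
  iid_uniform_entries Pr M ->
  pmf_of Pr M x = \prod_(ij : 'I_m * 'I_n) (#|F|%:R)^-1.
Proof.
case=> indep unif.
have := indep (fun ij => [set x ij.1 ij.2]).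
have -> : ([set w | forall ij : 'I_m * 'I_n, M w ij.1 ij.2 \in [set x ij.1 ij.2]%SET] =
    M @^-1` [set x])%classic.
  apply/seteqP; split => w /=; last by move=> -> ij; rewrite inE.
  by move=> Mx; apply/matrixP => i j; have := Mx (i, j); rewrite inE => /eqP.
rewrite /pmf_of => ->; apply: eq_bigr => -[i j] _; rewrite -(unif i j (x i j)).
exact: prob_in1.
Qed.

(** A point event for the whole noise is an intersection of point events, one per matrix, so its
    probability is a product of factors that depend only on the matrix shapes. The one-time pad
    needs only that this value is the same for all keys. *)
Lemma noise_uniform (R : realType) (dsp : measure_display)
    (Omega : measurableType dsp) (Pr : probability Omega R)
    (F : finFieldType) (PC m n k : nat)
    (N : 'I_PC -> Omega -> 'M[F]_(m, n)) (N' : 'I_PC -> Omega -> 'M[F]_(n, k)) :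
  (forall r, iid_uniform_entries Pr (N r)) ->
  (forall r, iid_uniform_entries Pr (N' r)) ->
  mutually_independent Pr (noise_family N N') ->
  exists c, forall u,
    pmf_of Pr (joint (joint_family N) (joint_family N')) u = c.
Proof.
move=> unif unif' indep.
pose c (i : 'I_PC + 'I_PC) : R := if i is inl _
  then \prod_(ij : 'I_m * 'I_n) (#|F|%:R)^-1
  else \prod_(ij : 'I_n * 'I_k) (#|F|%:R)^-1.
exists (\prod_i c i) => -[u u'].
pose e (i : 'I_PC + 'I_PC) : {set noise_space F m n k i} :=
  match i with inl r => [set u r] | inr r => [set u' r] end.
have := indep e.
have -> : ([set w | forall i, noise_family N N' i w \in e i] =
    joint (joint_family N) (joint_family N') @^-1` [set (u, u')])%classic.
  apply/seteqP; split => w /=; rewrite /joint /joint_family.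
    move=> Ne; congr (_, _); apply/ffunP => r; rewrite ffunE.
      by have := Ne (inl r); rewrite /= inE => /eqP.
    by have := Ne (inr r); rewrite /= inE => /eqP.
  by case=> hu hu' [r|r] /=; rewrite inE -?hu -?hu' ffunE.
rewrite /pmf_of => ->; apply: eq_bigr => -[r|r] _ /=.
  rewrite -(pmf_iid_uniform_entries (u r) (unif r)).
  exact: prob_in1.
rewrite -(pmf_iid_uniform_entries (u' r) (unif' r)).
exact: prob_in1.
Qed.

(** * Polynomials determined by their values *)

(** The difference has [#|Q|] distinct roots, while its degree is smaller than [#|Q|]. *)
Lemma poly_eq_on (F : fieldType) (P : nat) (z : 'I_P -> F) (Q : {set 'I_P})
    (p q : {poly F}) :
  injective z -> (size p <= #|Q|)%N -> (size q <= #|Q|)%N ->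
  (forall x, x \in Q -> p.[z x] = q.[z x]) -> p = q.
Proof.
move=> z_inj sp sq pq; apply/eqP; rewrite -subr_eq0; apply/eqP.
apply: (@roots_geq_poly_eq0 _ _ [seq z x | x <- enum Q]).
- apply/allP => _ /mapP[x + ->]; rewrite mem_enum => xQ.
  by rewrite rootE hornerD hornerN pq // subrr.
- by rewrite map_inj_uniq ?enum_uniq.
- rewrite size_map -cardE (leq_trans (size_polyD _ _)) //.
  by rewrite size_polyN geq_max sp.
Qed.

Lemma size_sum_leq (F : nzRingType) (I : finType) (f : I -> {poly F}) (n : nat) :
  (forall i, (size (f i) <= n)%N) -> (size (\sum_i f i)%R <= n)%N.
Proof.
move=> fn; apply: (big_ind (fun p : {poly F} => (size p <= n)%N)) => //.
  by rewrite size_poly0.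
by move=> p q pn qn; rewrite (leq_trans (size_polyD _ _)) // geq_max pn.
Qed.

Lemma size_monom_leq (F : nzRingType) (e n : nat) (c : F) :
  (e < n)%N -> (size ('X^e * c%:P)%R <= n)%N.
Proof.
move=> en; rewrite (leq_trans (size_polyMleq _ _)) // size_polyXn.
by have := size_polyC_leq1 c; lia.
Qed.

Lemma coef_mul_monom (F : comNzRingType) (e f n : nat) (a b : F) :
  (('X^e * a%:P) * ('X^f * b%:P))`_n = (n == (e + f)%N)%:R * (a * b).
Proof. by rewrite mulrACA -exprD -polyCM coefMC coefXn. Qed.

(** This is the invertibility of a scaled Vandermonde matrix: the common factor ['X^e] cancels at
    the non-zero points, and what remains has degree below [PC] and is known at [PC] points. *)
Lemma noise_poly_inj (F : fieldType) (P PC e : nat) (z : 'I_P -> F)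
    (Q : {set 'I_P}) (rho rho' : 'I_PC -> F) :
  injective z -> (forall x, z x != 0) -> #|Q| = PC ->
  (forall x, x \in Q -> (\sum_(r < PC) 'X^(e + r) * (rho r)%:P).[z x] =
                        (\sum_(r < PC) 'X^(e + r) * (rho' r)%:P).[z x]) ->
  rho =1 rho'.
Proof.
move=> z_inj z_neq0 QPC eval_eq.
pose p (c : 'I_PC -> F) := \sum_(r < PC) 'X^r * (c r)%:P.
have factor c : \sum_(r < PC) 'X^(e + r) * (c r)%:P = 'X^e * p c.
  by rewrite mulr_sumr; apply: eq_bigr => r _; rewrite exprD mulrA.
have coef_p c (r : 'I_PC) : (p c)`_r = c r.
  rewrite coef_sum (bigD1 r) //= coefMC coefXn eqxx mul1r big1 ?addr0 // => j jr.
  by rewrite coefMC coefXn eq_sym val_eqE (negPf jr) mul0r.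
suff pp : p rho = p rho' by move=> r; rewrite -!coef_p pp.
apply: (poly_eq_on (Q := Q)) z_inj _ _ _.
- by apply: size_sum_leq => r; rewrite QPC size_monom_leq.
- by apply: size_sum_leq => r; rewrite QPC size_monom_leq.
move=> x xQ; have := eval_eq x xQ; rewrite !factor !hornerM hornerXn.
by apply: mulfI; rewrite expf_neq0.
Qed.

(** * Scalar encoding polynomials: exponents, coefficients and degrees *)

Definition left_poly (F : nzRingType) (t s PC : nat) (alpha : 'I_t -> 'I_s -> F)
    (rho : 'I_PC -> F) : {poly F} :=
  \sum_(i < t) \sum_(j < s) 'X^(s * i + j) * (alpha i j)%:P +
  \sum_(r < PC) 'X^(t * s + r) * (rho r)%:P.

(** The parameter [u] plays the part of $t^*$. It is left free because the coefficient extraction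
    uses only [t * s + PC <= u * s]. *)
Definition right_poly (F : nzRingType) (u s d PC : nat)
    (beta : 'I_s -> 'I_d -> F) (rho : 'I_PC -> F) : {poly F} :=
  \sum_(k < s) \sum_(l < d) 'X^(s - k.+1 + u * s * l) * (beta k l)%:P +
  \sum_(r < PC) 'X^(u * s * d + r) * (rho r)%:P.

(** Since [j + (s - 1 - k)] lies between 0 and [2s - 2], it is congruent to [s - 1] modulo [s] only
    when [j = k]. The quotients [i + u * l] and [i' + u * l'] are then two-digit expansions in base
    [u], with low digits below [t <= u]. *)
Lemma block_monom_target (s t u i i' j k l l' : nat) :
  (j < s)%N -> (k < s)%N -> (i < t)%N -> (i' < t)%N -> (t <= u)%N ->
  (s * i + s.-1 + u * s * l == s * i' + j + (s - k.+1 + u * s * l'))%N =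
  [&& i' == i, l' == l & j == k].
Proof.
move=> js ks it i't tu; apply/eqP/and3P; last first.
  by move=> [/eqP-> /eqP-> /eqP->]; lia.
move=> e.
(* Unequal quotients would put the two sides at least [s] apart, more than the remainders can make
   up. *)
have q : (i + u * l = i' + u * l')%N.
  have : (s * (i + u * l) + s.-1 = s * (i' + u * l') + j + (s - k.+1))%N.
    by move: e; rewrite !mulnDr !mulnA ![(s * u)%N]mulnC; lia.
  case: (ltngtP (i + u * l) (i' + u * l'))%N => // lt.
    by have := leq_mul (leqnn s) lt; rewrite mulnS; lia.
  by have := leq_mul (leqnn s) lt; rewrite mulnS; lia.
have ll : l' = l.
  case: (ltngtP l' l) => // lt.
    by have := leq_mul (leqnn u) lt; rewrite mulnS; lia.
  by have := leq_mul (leqnn u) lt; rewrite mulnS; lia.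
subst l'; have ii : i' = i by lia.
by subst i'; split=> //; apply/eqP; lia.
Qed.

(* Modulo [u * s] the exponents of the wanted coefficients lie in
   [s - 1, t * s), which the noise on the left encoding avoids. *)
Lemma left_noise_avoids_target (s t u PC i r k l l' : nat) :
  (k < s)%N -> (i < t)%N -> (r < PC)%N -> (t * s + PC <= u * s)%N ->
  (s * i + s.-1 + u * s * l == t * s + r + (s - k.+1 + u * s * l'))%N = false.
Proof.
move=> ks it rPC tu; apply/eqP => e.
have := leq_mul (leqnn s) it; rewrite mulnS (mulnC s t) => it'.
(* For [l <= l'] the noise exponent is too large, as [s * i + s <= t * s]. For [l' < l] it is at
   most [u * s * l' + u * s + s - 2], one short of the least target exponent for [l]. *)
have [ll | ll] := leqP l l'.
  by have := leq_mul (leqnn (u * s)) ll; lia.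
by have := leq_mul (leqnn (u * s)) ll; rewrite mulnS; lia.
Qed.

Lemma coef_left_right (F : comNzRingType) (t s d u PC : nat)
    (alpha : 'I_t -> 'I_s -> F) (beta : 'I_s -> 'I_d -> F)
    (rho rho' : 'I_PC -> F) (i : 'I_t) (l : 'I_d) :
  (t * s + PC <= u * s)%N ->
  (left_poly alpha rho * right_poly u beta rho')`_(s * i + s.-1 + u * s * l) =
  \sum_k alpha i k * beta k l.
Proof.
move=> tu; set n := (X in _`_X).
(* If [s = 0], then [tu] forces [PC = 0] and both sides vanish. *)
have [s0 | s_gt0] := posnP s.
  rewrite [RHS]big1 => [|k _]; last by have := ltn_ord k; lia.
  have PC0 : PC = 0%N by lia.
  rewrite /left_poly !big1 ?addr0 ?mul0r ?coef0 // => j _.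
    by have := ltn_ord j; lia.
  by rewrite big1 // => k _; have := ltn_ord k; lia.
have t_le_u : (t <= u)%N by rewrite -(leq_pmul2r s_gt0); lia.
(* The noise on the right starts at exponent [u * s * d], so both products that involve it miss the
   coefficient [n]. *)
have n_lt : (n < u * s * d)%N.
  have := leq_mul (leqnn s) (ltn_ord i); rewrite mulnS (mulnC s t).
  have := leq_mul (leqnn (u * s)) (ltn_ord l); rewrite mulnS.
  by rewrite /n; lia.
rewrite /left_poly /right_poly mulrDl !mulrDr !coefD.
rewrite [X in _ + X + _](_ : _ = 0) ?addr0; last first.
  rewrite big_distrlr /= coef_sum big1 // => i' _; rewrite coef_sum big1 // => r _.
  rewrite mulr_suml coef_sum big1 // => j _.
  by rewrite coef_mul_monom (_ : _ == _ = false) ?mul0r //; lia.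
rewrite [X in _ + (X + _)](_ : _ = 0) ?add0r; last first.
  rewrite big_distrlr /= coef_sum big1 // => r _; rewrite coef_sum big1 // => k _.
  rewrite mulr_sumr coef_sum big1 // => l' _.
  by rewrite coef_mul_monom (left_noise_avoids_target _ _ _ _ _ tu) ?mul0r.
rewrite [X in _ + X](_ : _ = 0) ?addr0; last first.
  rewrite big_distrlr /= coef_sum big1 // => r _; rewrite coef_sum big1 // => r' _.
  by rewrite coef_mul_monom (_ : _ == _ = false) ?mul0r //; lia.
rewrite big_distrlr /= coef_sum.
(* Only data times data is left. The sums over [i'], [j] and [l'] collapse to [i], [k] and [l],
   leaving the inner product over [k]. *)
have term (i' : 'I_t) (k j : 'I_s) (l' : 'I_d) : (('X^(s * i' + j) * (alpha i' j)%:P) *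
    ('X^(s - k.+1 + u * s * l') * (beta k l')%:P))`_n =
    ([&& i' == i, l' == l & j == k])%:R * (alpha i' j * beta k l').
  by rewrite coef_mul_monom (block_monom_target _ _ _ _ _ _ t_le_u).
rewrite (bigD1 i) //= [X in _ + X]big1 ?addr0 => [|i' i'i]; last first.
  rewrite coef_sum big1 // => k _; rewrite big_distrlr /= coef_sum big1 // => j _.
  by rewrite coef_sum big1 // => l' _; rewrite term (negPf i'i) mul0r.
rewrite coef_sum; apply: eq_bigr => k _; rewrite big_distrlr /= coef_sum.
rewrite (bigD1 k) //= [X in _ + X]big1 ?addr0 => [|j jk]; last first.
  by rewrite coef_sum big1 // => l' _; rewrite term (negPf jk) !andbF mul0r.
rewrite coef_sum (bigD1 l) //= [X in _ + X]big1 ?addr0 => [|l' l'l]; last first.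
  by rewrite term (negPf l'l) andbF mul0r.
by rewrite term !eqxx mul1r.
Qed.

(** For [PC > 0] the factors have sizes at most [t * s + PC] and [u * s * d + PC]. As
    [u * s = t * s + s * Delta s PC], the product has size at most [u * s * d.+1 - s * Delta s PC +
    2 * PC - 1]; both noisy cases of the threshold equal this bound. *)
Lemma size_left_right (F : nzRingType) (t s d PC : nat)
    (alpha : 'I_t -> 'I_s -> F) (beta : 'I_s -> 'I_d -> F)
    (rho rho' : 'I_PC -> F) :
  (0 < s)%N -> (0 < d)%N ->
  (size (left_poly alpha rho * right_poly (tstar t s PC) beta rho')%R <=
   recovery_threshold t s d PC)%N.
Proof.
move=> s_gt0 d_gt0; set u := tstar t s PC.
have us : (u * s = t * s + s * Delta s PC)%N.
  by rewrite /u /tstar mulnDl [(Delta _ _ * _)%N]mulnC.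
have PC_le : (PC <= s * Delta s PC)%N by rewrite mulnC -ceil_div_leq.
have left_size : (size (left_poly alpha rho) <= t * s + PC)%N.
  rewrite (leq_trans (size_polyD _ _)) // geq_max; apply/andP; split.
    apply: size_sum_leq => i; apply: size_sum_leq => j; apply: size_monom_leq.
    have := leq_mul (leqnn s) (ltn_ord i); rewrite mulnS (mulnC s t).
    by have := ltn_ord j; lia.
  by apply: size_sum_leq => r; apply: size_monom_leq; rewrite ltn_add2l.
have data_size : (size (\sum_(k < s) \sum_(l < d)
    'X^(s - k.+1 + u * s * l) * (beta k l)%:P)%R <= s + u * s * d.-1)%N.
  apply: size_sum_leq => k; apply: size_sum_leq => l; apply: size_monom_leq.
  have : (u * s * l <= u * s * d.-1)%N.
    by rewrite leq_mul2l -ltnS prednK // ltn_ord orbT.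
  by have := ltn_ord k; lia.
apply: leq_trans (size_polyMleq _ _) _.
rewrite /recovery_threshold -/u; case: (posnP PC) => PC0.
  (* Without noise [Delta] is 0, and the right factor ends at its last data exponent, at most
     [s - 1 + t * s * d.-1]. *)
  have u_t : u = t.
    by rewrite /u /tstar /Delta /ceil_div PC0 divn_small ?addn0; lia.
  have right_size : (size (right_poly u beta rho') <= s + u * s * d.-1)%N.
    rewrite /right_poly [X in _ + X]big1 ?addr0 // => r _.
    by have := ltn_ord r; lia.
  have : (t * s * d = t * s + t * s * d.-1)%N by rewrite -mulnS prednK.
  by move: right_size left_size; rewrite u_t; lia.
have right_size : (size (right_poly u beta rho') <= u * s * d + PC)%N.
  rewrite (leq_trans (size_polyD _ _)) // geq_max; apply/andP; split.
    apply: leq_trans data_size _.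
    have : (u * s * d = u * s + u * s * d.-1)%N by rewrite -mulnS prednK.
    (* Noise is present, so [Delta] is at least 1. Hence [s <= u * s], and the data monomials stay
       below [u * s * d]. *)
    have : (s <= s * Delta s PC)%N.
      by rewrite leq_pmulr // lt0n; apply/eqP => D0; move: PC_le; rewrite D0; lia.
    lia.
  by apply: size_sum_leq => r; apply: size_monom_leq; rewrite ltn_add2l.
have usd : (u * s * d.+1 = u * s * d + u * s)%N by rewrite mulnS addnC.
(* When [s] divides [PC], [s * Delta s PC = PC] turns the general bound into the second formula. *)
case: eqP => [ratio | _]; last first.
  by rewrite usd; lia.
have : (Delta s PC)%:R * s%:R = PC%:R :> rat.
  by rewrite ratio divfK // pnatr_eq0 -lt0n.
rewrite -natrM => /eqP; rewrite eqr_nat => /eqP ratio'.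
by rewrite usd; lia.
Qed.

(** * Block partitions of matrices *)

Lemma block_index_bij (n k : nat) : (k %| n)%N ->
  bijective (fun ia : 'I_k * 'I_(n %/ k) => block_index ia.1 ia.2).
Proof.
move=> kn; apply: inj_card_bij; last by rewrite card_prod !card_ord mulnC divnK.
move=> [i a] [j b] /(congr1 val) /= e.
(* The offset [a] witnesses a non-empty block, so dividing by [n %/ k] recovers the block number. *)
have q_gt0 : (0 < n %/ k)%N by apply: leq_ltn_trans (ltn_ord a).
have ij : i = j :> nat.
  by have := congr1 (divn^~ (n %/ k)%N) e; rewrite /= !divnMDl // !divn_small // !addn0.
have ab : a = b :> nat by move: e; rewrite ij => /addnI.
by congr (_, _); apply: val_inj.
Qed.

Lemma block_inj (F : Type) (m n k l : nat) (M M' : 'M[F]_(m, n)) :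
  (k %| m)%N -> (l %| n)%N ->
  (forall (i : 'I_k) (j : 'I_l), block M i j = block M' i j) -> M = M'.
Proof.
move=> km ln MM'; apply/matrixP => x y.
have [f _ fK] := block_index_bij km; have [g _ gK] := block_index_bij ln.
have /matrixP/(_ (f x).2 (g y).2) := MM' (f x).1 (g y).1.
by rewrite !mxE fK gK.
Qed.

Lemma block_mulmx (F : nzRingType) (T S D t s d : nat)
    (A : 'M[F]_(T, S)) (B : 'M[F]_(S, D)) (i : 'I_t) (l : 'I_d) :
  (s %| S)%N ->
  block (A *m B) i l = \sum_(k < s) block A i k *m block B k l.
Proof.
move=> sS; apply/matrixP => a b; rewrite summxE !mxE.
rewrite (reindex _ (onW_bij _ (block_index_bij sS))) /=.
rewrite -(pair_bigA _ (fun k c =>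
  A (block_index i a) (block_index k c) * B (block_index k c) (block_index l b))).
by apply: eq_bigr => k _; rewrite mxE; apply: eq_bigr => c _; rewrite !mxE.
Qed.

(** * Matrix encoding polynomials, reduced entrywise to the scalar ones *)

Lemma Fa_entry (F : finFieldType) (t s PC T S : nat) (A : 'M[F]_(T, S))
    (N : 'I_PC -> 'M[F]_(T %/ t, S %/ s)) a c :
  Fa A N a c = left_poly (fun i j => block A i j a c) (fun r => N r a c).
Proof.
rewrite /Fa /left_poly mxE !summxE; congr (_ + _); apply: eq_bigr => i _.
  by rewrite summxE; apply: eq_bigr => j _; rewrite !mxE.
by rewrite !mxE.
Qed.

Lemma Fb_entry (F : finFieldType) (t s d PC S D : nat) (B : 'M[F]_(S, D))
    (N : 'I_PC -> 'M[F]_(S %/ s, D %/ d)) c b :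
  Fb t B N c b =
  right_poly (tstar t s PC) (fun k l => block B k l c b) (fun r => N r c b).
Proof.
rewrite /Fb /right_poly mxE !summxE; congr (_ + _); apply: eq_bigr => i _.
  by rewrite summxE; apply: eq_bigr => j _; rewrite !mxE.
by rewrite !mxE.
Qed.

Lemma eval_mxpolyE (F : finFieldType) (m n : nat) (G : 'M[{poly F}]_(m, n))
    (x : F) a b :
  eval_mxpoly G x a b = (G a b).[x].
Proof. by rewrite mxE. Qed.

Lemma eval_mxpolyM (F : finFieldType) (m n k : nat)
    (G : 'M[{poly F}]_(m, n)) (H : 'M[{poly F}]_(n, k)) (x : F) :
  eval_mxpoly G x *m eval_mxpoly H x = eval_mxpoly (G *m H) x.
Proof.
apply/matrixP => a b; rewrite !mxE horner_sum; apply: eq_bigr => c _.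
by rewrite !mxE hornerM.
Qed.

(** The data matrix is the same on both sides, so its contribution cancels in each entry and only
    the noise polynomials remain to be compared. *)
Lemma Fa_noise_inj (F : finFieldType) (P t s PC T S : nat) (z : 'I_P -> F)
    (Q : {set 'I_P}) (A : 'M[F]_(T, S))
    (N N' : 'I_PC -> 'M[F]_(T %/ t, S %/ s)) :
  injective z -> (forall x, z x != 0) -> #|Q| = PC ->
  (forall x, x \in Q ->
     eval_mxpoly (Fa A N) (z x) = eval_mxpoly (Fa A N') (z x)) ->
  N =1 N'.
Proof.
move=> z_inj z_neq0 QPC eval_eq r; apply/matrixP => a b; move: r.
apply: (noise_poly_inj (e := t * s)) z_inj z_neq0 QPC _ => x xQ.
have /matrixP/(_ a b) := eval_eq x xQ.
by rewrite !eval_mxpolyE !Fa_entry !hornerD => /addrI.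
Qed.

Lemma Fb_noise_inj (F : finFieldType) (P t s d PC S D : nat) (z : 'I_P -> F)
    (Q : {set 'I_P}) (B : 'M[F]_(S, D))
    (N N' : 'I_PC -> 'M[F]_(S %/ s, D %/ d)) :
  injective z -> (forall x, z x != 0) -> #|Q| = PC ->
  (forall x, x \in Q ->
     eval_mxpoly (Fb t B N) (z x) = eval_mxpoly (Fb t B N') (z x)) ->
  N =1 N'.
Proof.
move=> z_inj z_neq0 QPC eval_eq r; apply/matrixP => a b; move: r.
apply: (noise_poly_inj (e := tstar t s PC * s * d)) z_inj z_neq0 QPC _ => x xQ.
have /matrixP/(_ a b) := eval_eq x xQ.
by rewrite !eval_mxpolyE !Fb_entry !hornerD => /addrI.
Qed.

Lemma coef_Fa_Fb (F : finFieldType) (t s d PC T S D : nat)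
    (A : 'M[F]_(T, S)) (B : 'M[F]_(S, D))
    (N : 'I_PC -> 'M[F]_(T %/ t, S %/ s))
    (N' : 'I_PC -> 'M[F]_(S %/ s, D %/ d)) (i : 'I_t) (l : 'I_d) a b :
  (0 < s)%N -> (s %| S)%N ->
  ((Fa A N *m Fb t B N') a b)`_(s * i + s.-1 + tstar t s PC * s * l) =
  block (A *m B) i l a b.
Proof.
move=> s_gt0 sS; rewrite mxE (block_mulmx _ _ _ _ sS) summxE coef_sum.
under [RHS]eq_bigr do rewrite mxE.
rewrite [RHS]exchange_big /=.
apply: eq_bigr => c _; rewrite Fa_entry Fb_entry coef_left_right //.
(* Rounding up in [Delta] leaves room for all the left noise within one period [u * s]. *)
have : (PC <= Delta s PC * s)%N by rewrite -ceil_div_leq.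
by rewrite /tstar mulnDl leq_add2l.
Qed.

(** Data and noise may both differ between the two runs: this is the outcome-by-outcome form that
    [cond_entropy_determined] asks for. *)
Lemma outputs_determine_product (F : finFieldType) (P t s d PC T S D : nat)
    (z : 'I_P -> F) (Q : {set 'I_P})
    (A1 A2 : 'M[F]_(T, S)) (B1 B2 : 'M[F]_(S, D))
    (N1 N2 : 'I_PC -> 'M[F]_(T %/ t, S %/ s))
    (N1' N2' : 'I_PC -> 'M[F]_(S %/ s, D %/ d)) :
  (0 < s)%N -> (0 < d)%N -> (t %| T)%N -> (s %| S)%N -> (d %| D)%N ->
  injective z -> #|Q| = recovery_threshold t s d PC ->
  (forall x, x \in Q ->
     eval_mxpoly (Fa A1 N1) (z x) *m eval_mxpoly (Fb t B1 N1') (z x) =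
     eval_mxpoly (Fa A2 N2) (z x) *m eval_mxpoly (Fb t B2 N2') (z x)) ->
  A1 *m B1 = A2 *m B2.
Proof.
move=> s_gt0 d_gt0 tT sS dD z_inj QPR eval_eq.
have size_entry A B (N : 'I_PC -> 'M[F]_(T %/ t, S %/ s))
    (N' : 'I_PC -> 'M[F]_(S %/ s, D %/ d)) a b :
    (size ((Fa A N *m Fb t B N') a b) <= #|Q|)%N.
  rewrite mxE QPR; apply: size_sum_leq => c.
  by rewrite Fa_entry Fb_entry size_left_right.
apply: (block_inj tT dD) => i l; apply/matrixP => a b.
rewrite -(coef_Fa_Fb A1 B1 N1 N1') // -(coef_Fa_Fb A2 B2 N2 N2') //.
congr (nth 0 (polyseq _) _); apply: (poly_eq_on z_inj (size_entry _ _ _ _ _ _)) => //.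
move=> x xQ; have /matrixP/(_ a b) := eval_eq x xQ.
by rewrite !eval_mxpolyM !eval_mxpolyE.
Qed.

(** * Security, decodability and communication load of the code *)

Theorem theorem1 (R : realType) (dsp : measure_display)
    (Omega : measurableType dsp) (Pr : probability Omega R)
    (F : finFieldType) (P PC t s d T S D : nat)
    (t_gt0 : (0 < t)%N) (s_gt0 : (0 < s)%N) (d_gt0 : (0 < d)%N)
    (s_lt_t : (s < t)%N)
    (tT : (t %| T)%N) (sS : (s %| S)%N) (dD : (d %| D)%N)
    (PC_lt_P : (PC < P)%N) (P_lt_F : (P < #|F|)%N)
    (PR_le_P : (recovery_threshold t s d PC <= P)%N)
    (A : Omega -> 'M[F]_(T, S)) (B : Omega -> 'M[F]_(S, D))
    (N : 'I_PC -> Omega -> 'M[F]_(T %/ t, S %/ s))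
    (N' : 'I_PC -> Omega -> 'M[F]_(S %/ s, D %/ d))
    (A_rv : discrete_rv A) (B_rv : discrete_rv B)
    (N_rv : forall r, discrete_rv (N r)) (N'_rv : forall r, discrete_rv (N' r))
    (A_unif : iid_uniform_entries Pr A) (B_unif : iid_uniform_entries Pr B)
    (N_unif : forall r, iid_uniform_entries Pr (N r))
    (N'_unif : forall r, iid_uniform_entries Pr (N' r))
    (AB_indep : independent_pair Pr A B)
    (noise_indep : mutually_independent Pr (noise_family N N'))
    (noise_data_indep :
       independent_pair Pr (joint (joint_family N) (joint_family N'))
         (joint A B))
    (z : 'I_P -> F) (z_inj : injective z) (z_neq0 : forall p, z p != 0) :
  let PR := recovery_threshold t s d PC in
  let Ap := enc_A A N z in
  let Bp := enc_B t B N' z in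
  let Cp := worker_output Ap Bp in
  [/\ secure Pr PC A B Ap Bp,
      decodable Pr PR A B Cp
    & forall (Q : {set 'I_P}) (w : Omega), #|Q| = PR ->
        (comm_load Cp Q w)%:R =
          PR%:R * ((T%:R * D%:R) / (t%:R * d%:R)) :> rat].
Proof.
move=> PR Ap Bp Cp; split.
- move=> Q QPC.
  (* The noise [u] is the key and the data [y] the message; [phi] gives the shares of the workers in
     [Q]. *)
  pose phi (u : {ffun 'I_PC -> 'M[F]_(T %/ t, S %/ s)} *
                {ffun 'I_PC -> 'M[F]_(S %/ s, D %/ d)})
      (y : 'M[F]_(T, S) * 'M[F]_(S, D)) :=
    ([ffun p : {p | p \in Q} => eval_mxpoly (Fa y.1 u.1) (z (val p))],
     [ffun p : {p | p \in Q} => eval_mxpoly (Fb t y.2 u.2) (z (val p))]).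
  have -> : joint (restricted Q Ap) (restricted Q Bp) = fun w =>
      phi (joint (joint_family N) (joint_family N') w) (joint A B w).
    apply: funext => w; congr (_, _); apply/ffunP => p; rewrite !ffunE /=.
      by rewrite /Ap /enc_A; congr (eval_mxpoly (Fa _ _) _); apply: funext => r;
        rewrite ffunE.
    by rewrite /Bp /enc_B; congr (eval_mxpoly (Fb _ _ _) _); apply: funext => r;
      rewrite ffunE.
  have [c noise_c] := noise_uniform N_unif N'_unif noise_indep.
  apply: mutual_info_one_time_pad noise_data_indep noise_c _ _.
  + by apply: discrete_joint; apply: discrete_joint_family.
  + exact: discrete_joint.
  (* As [#|Q| = PC], there are as many shares as noise matrices on each side, of the same shapes. *)
  + by rewrite !card_prod !card_ffun card_sig card_ord QPC.
  + move=> y [u v] [u' v'] [/ffunP eu /ffunP ev].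
    congr (_, _); apply/ffunP.
      apply: Fa_noise_inj z_inj z_neq0 QPC _ => x xQ.
      by have := eu (exist _ x xQ); rewrite !ffunE; apply.
    apply: Fb_noise_inj z_inj z_neq0 QPC _ => x xQ.
    by have := ev (exist _ x xQ); rewrite !ffunE; apply.
- move=> Q QPR; apply: cond_entropy_determined => w w' /ffunP eC.
  apply: (outputs_determine_product s_gt0 d_gt0 tT sS dD z_inj QPR) => x xQ.
  by have := eC (exist _ x xQ); rewrite !ffunE; apply.
- move=> Q w QPR; rewrite /comm_load /num_entries sum_nat_const QPR.
  rewrite card_prod !card_ord !natrM; congr (_ * _).
  (* Only [T] and [D] on the right are expanded as quotient times divisor, so that [t] and [d]
     cancel. *)
  rewrite -{2}(divnK tT) -{2}(divnK dD) !natrM.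
  by field; rewrite !pnatr_eq0 -!lt0n; apply/andP.
Qed.
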